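(* Let $\varphi:\mathbb{R}^n\to\mathbb{R}\cup\{+\infty\}$ be a proper, lower semicontinuous, coercive function that is uniformly quasiconvex with modulus $\phi$ on a nonempty closed convex set $C\subseteq\operatorname{dom}\varphi$. Let $p>1$ and let $\{x^k\}_{k\ge 0}$ be a sequence generated by HiPPA with order $p$ and parameters $\gamma_k\in(\gamma_{\min},\gamma_{\max})$. Then: (a) the sequences $\{\varphi(x^k)\}_{k\ge 0}$ and $\{\varphi^p_{\gamma_k}(C,x^k)\}_{k\ge 0}$ are decreasing; (b) $\sum_{k=0}^\infty\|x^{k+1}-x^k\|^p<\infty$; (c) the sequence $\{x^k\}_{k\ge 0}$ is bounded; (d) the set of cluster points of $\{x^k\}_{k\ge0}$ equals $\arg\min_{x\in C}\varphi(x)$; (e) the sequence $\{x^k\}_{k\ge0}$ converges to $\overline{x}$, where $\{\overline{x}\}=\arg\min_{x\in C}\varphi(x)$.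
   Context: $\|\cdot\|$ is the Euclidean norm on $\mathbb{R}^n$; $\operatorname{dom}\varphi=\{x:\varphi(x)<+\infty\}$; $\varphi$ is proper if $\operatorname{dom}\varphi\ne\emptyset$, and coercive if $\varphi(x)\to+\infty$ as $\|x\|\to+\infty$. A cluster point of a sequence is the limit of one of its subsequences. A modulus is an increasing function $\phi:[0,+\infty)\to[0,+\infty]$ that vanishes only at $0$. The function $\varphi$ is uniformly quasiconvex with modulus $\phi$ on a convex set $C\subseteq\operatorname{dom}\varphi$ if for all $x,y\in C$ and $\lambda\in[0,1]$, $$\varphi(\lambda x+(1-\lambda)y)+\lambda(1-\lambda)\phi(\|x-y\|)\le\max\{\varphi(x),\varphi(y)\}.$$ The high-order Moreau envelope is $\varphi^p_\gamma(C,x):=\inf_{y\in C}\left(\varphi(y)+\frac{1}{p\gamma}\|x-y\|^p\right)$ for $\gamma>0$. HiPPA (high-order proximal-point algorithm) of order $p>1$: fix $\gamma_{\max}>\gamma_{\min}>0$ and $x^0\in C$; for $k=0,1,2,\dots$, while the stopping criteria do not hold, select $\gamma_k\in(\gamma_{\min},\gamma_{\max})$ and compute $$x^{k+1}\in\arg\min_{y\in C}\left(\varphi(y)+\frac{1}{p\gamma_k}\|x^k-y\|^p\right).$$ (Under the hypotheses of the claim these sets of minimizers are nonempty, and $\varphi$ has a unique minimizer on $C$.) *)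

(* Defs.v *)
From mathcomp Require Import all_boot all_order all_algebra.
From mathcomp Require Import all_classical all_reals all_analysis.
Set Implicit Arguments.
Unset Strict Implicit.
Unset Printing Implicit Defensive.
Import Order.TTheory GRing.Theory Num.Theory.
Import numFieldNormedType.Exports.
Local Open Scope classical_set_scope.
Local Open Scope ring_scope.

(* The library norm on 'rV[R]_n is the sup norm, hence this definition; the
   library topology on 'rV[R]_n is the one induced by eucl_norm. *)
Definition eucl_norm (R : realType) (n : nat) (x : 'rV[R]_n) : R :=
  Num.sqrt (\sum_(i < n) x ord0 i ^+ 2).

(* Functions to R U {+oo} are represented as functions to \bar R that never
   take the value -oo. *)
Definition proper_fun (R : realType) (T : Type) (f : T -> \bar R) : Prop :=
  (forall x, f x != -oo%E) /\ (exists x, (f x < +oo)%E).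

Definition dom (R : realType) (T : Type) (f : T -> \bar R) : set T :=
  [set x | (f x < +oo)%E].

Definition coercive (R : realType) (n : nat) (f : 'rV[R]_n -> \bar R) : Prop :=
  forall M : R, exists r : R, forall x, r < eucl_norm x -> (M%:E < f x)%E.

(* A modulus [0, +oo[ -> [0, +oo] is represented by a function on R of which
   only the values at nonnegative arguments matter; "increasing" is understood
   in the wide sense. *)
Definition is_modulus (R : realType) (m : R -> \bar R) : Prop :=
  [/\ forall t, 0 <= t -> (0 <= m t)%E,
      forall s t, 0 <= s -> s <= t -> (m s <= m t)%E
    & forall t, 0 <= t -> (m t = 0%E <-> t = 0)].

(* In \bar R, 0 * +oo = 0, so the inequality is trivial for l = 0 and l = 1
   even when m is infinite. *)
Definition uniformly_quasiconvex_on (R : realType) (n : nat)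
    (m : R -> \bar R) (C : set 'rV[R]_n) (f : 'rV[R]_n -> \bar R) : Prop :=
  forall (x y : 'rV[R]_n) (l : R), C x -> C y -> 0 <= l <= 1 ->
    (f (l *: x + (1 - l) *: y)%R
       + (l * (1 - l))%:E * m (eucl_norm (x - y)%R)
     <= maxe (f x) (f y))%E.

Definition argmin_on (R : realType) (T : Type) (C : set T) (f : T -> \bar R)
    : set T :=
  [set x | C x /\ forall y, C y -> (f x <= f y)%E].

Definition prox_objective (R : realType) (n : nat) (f : 'rV[R]_n -> \bar R)
    (p g : R) (x y : 'rV[R]_n) : \bar R :=
  (f y + ((p * g)^-1 * eucl_norm (x - y)%R `^ p)%:E)%E.

Definition moreau_envelope (R : realType) (n : nat) (f : 'rV[R]_n -> \bar R)
    (p g : R) (C : set 'rV[R]_n) (x : 'rV[R]_n) : \bar R :=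
  ereal_inf [set prox_objective f p g x y | y in C].

(* An infinite run, i.e. one in which the stopping criteria are never met. *)
Definition hippa_sequence (R : realType) (n : nat) (f : 'rV[R]_n -> \bar R)
    (C : set 'rV[R]_n) (p gmin gmax : R) (g : nat -> R)
    (x : nat -> 'rV[R]_n) : Prop :=
  [/\ C (x 0%N),
      forall k, gmin < g k < gmax
    & forall k, argmin_on C (prox_objective f p (g k) (x k)) (x k.+1)].

Definition cluster_points (T : topologicalType) (x : nat -> T) : set T :=
  [set l | exists s : nat -> nat,
    {homo s : i j / (i < j)%N} /\ (fun k => x (s k)) @ \oo --> l].

(* Main.v *)
(** Comparing the proximal objective at [x k.+1] and at [x k] gives
    [phi (x k.+1) + |x k.+1 - x k|^p / (p * g k) <= phi (x k)]; telescoping shows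
    that the series of the [|x k.+1 - x k|^p] converges, so the steps tend to 0.
    Comparing it instead at [x k.+1] and at [l *: xb + (1 - l) *: x k.+1], where
    [xb] is the minimizer of [phi] on [C], uniform quasiconvexity gives
    [l (1 - l) m (|xb - x k.+1|) <= (|x k - x k.+1| + l |xb - x k.+1|)^p / (p gmin)].
    If [|xb - x k.+1| >= e] for arbitrarily large [k], then, as the steps tend to 0
    and the iterates are bounded, [l (1 - l) m e = O(l^p)], which fails for small
    [l] because [p > 1]. Hence [x] converges to [xb], its only cluster point. *)

Require Import Defs.
From mathcomp Require Import all_boot all_order all_algebra.
From mathcomp Require Import all_classical all_reals all_analysis.
From mathcomp Require Import ring lra.
Set Implicit Arguments.
Unset Strict Implicit.
Unset Printing Implicit Defensive.
Import Order.TTheory GRing.Theory Num.Theory.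
Import numFieldNormedType.Exports.
Local Open Scope classical_set_scope.
Local Open Scope ring_scope.

(** * Euclidean norm *)

Section eucl_norm.
Variables (R : realType) (n : nat).
Implicit Types (x y : 'rV[R]_n) (r : R).

Lemma eucl_norm_ge0 x : 0 <= eucl_norm x.
Proof. exact: sqrtr_ge0. Qed.

Lemma eucl_norm_le r x : 0 <= r ->
  (eucl_norm x <= r) = (\sum_(i < n) x ord0 i ^+ 2 <= r ^+ 2).
Proof.
move=> r0; rewrite -[in LHS](ger0_norm r0) -sqrtr_sqr ler_sqrt// sqr_ge0//.
Qed.

Lemma eucl_normZ r x : eucl_norm (r *: x) = `|r| * eucl_norm x.
Proof.
rewrite /eucl_norm -sqrtr_sqr -sqrtrM ?sqr_ge0//; congr Num.sqrt.
by rewrite mulr_sumr; apply: eq_bigr => i _; rewrite mxE exprMn.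
Qed.

Lemma eucl_normN x : eucl_norm (- x) = eucl_norm x.
Proof. by rewrite -scaleN1r eucl_normZ normrN1 mul1r. Qed.

Lemma eucl_norm_distC x y : eucl_norm (x - y) = eucl_norm (y - x).
Proof. by rewrite -eucl_normN opprB. Qed.

Lemma eucl_norm_eq0 x : eucl_norm x = 0 -> x = 0.
Proof.
move=> /eqP; rewrite sqrtr_eq0 => s0; apply/rowP => i; rewrite mxE.
have s00 : \sum_(i < n) x ord0 i ^+ 2 = 0.
  by apply/le_anti; rewrite s0 sumr_ge0// => j _; exact: sqr_ge0.
have /(_ i isT) /eqP := psumr_eq0P (fun j _ => sqr_ge0 (x ord0 j)) s00.
by rewrite sqrf_eq0 => /eqP.
Qed.

(* Loses a constant with respect to the triangle inequality, which is harmless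
   in [hippa_cvg] and spares the Cauchy-Schwarz inequality. *)
Lemma eucl_norm_add_le r x y : eucl_norm x <= r -> eucl_norm y <= r ->
  eucl_norm (x + y) <= 2 * r.
Proof.
move=> xr yr; have r0 : 0 <= r := le_trans (eucl_norm_ge0 x) xr.
move: xr yr; rewrite !eucl_norm_le ?mulr_ge0// => xr yr.
apply: (@le_trans _ _ (2 * (\sum_(i < n) x ord0 i ^+ 2
                            + \sum_(i < n) y ord0 i ^+ 2))); last by lra.
rewrite -big_split mulr_sumr/=; apply: ler_sum => i _; rewrite mxE.
by have := sqr_ge0 (x ord0 i - y ord0 i); lra.
Qed.

(** Carries Euclidean bounds over to the library norm, hence to boundedness and convergence. *)
Lemma normr_le_eucl_norm x : `|x| <= eucl_norm x.
Proof.
rewrite /Num.norm/= mx_normrE; apply: bigmax_le; first exact: eucl_norm_ge0.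
move=> [i j] _; rewrite (ord1 i)/= -sqrtr_sqr ler_wsqrtr//.
rewrite (bigD1 j)//= lerDl sumr_ge0// => k _; exact: sqr_ge0.
Qed.

End eucl_norm.

(** The sublevel sets of [f] in [A] are nested, so they form a filter base, which has a cluster
    point [x] by compactness. If [f a < f x], lower semicontinuity gives a neighbourhood of [x] that
    misses the sublevel set [B a]. *)
Lemma lsc_compact_argmin (R : realType) (T : topologicalType) (A : set T)
    (f : T -> \bar R) :
  (forall x, f x != -oo%E) -> lower_semicontinuous f ->
  compact A -> A !=set0 -> argmin_on A f !=set0.
Proof.
move=> fNy flsc Aco [a0 Aa0].
pose B a := A `&` [set x | (f x <= f a)%E].
have FF : Filter (filter_from A B).
  apply: filter_from_filter; first by exists a0.
  move=> a b Aa Ab; have [ab|ba] := leP (f a) (f b).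
    by exists a => // y [Ay ya]; split; split => //; exact: le_trans ab.
  by exists b => // y [Ay yb]; split; split => //; exact: le_trans (ltW ba).
have PF : ProperFilter (filter_from A B).
  by apply: filter_from_proper => a Aa; exists a; split => /=.
have [|x [Ax xcl]] := Aco _ PF; first by exists a0 => // y [].
exists x; split => // a Aa; rewrite leNgt; apply/negP => ax.
(* Lower semicontinuity takes real thresholds, so [f a] must be finite. *)
have fa : f a \is a fin_num.
  by rewrite fin_numE fNy/= lt_eqF// (lt_le_trans ax) ?leey.
have [V xV aV] : exists2 V, nbhs x V & forall y, V y -> (f a < f y)%E.
  by rewrite -(fineK fa); apply: flsc; rewrite fineK.
have [|y [[_ /= ya] /aV]] := xcl (B a) V _ xV; first by exists a.
by rewrite ltNge ya.
Qed.

Lemma convex_set_comb (R : realType) (n : nat) (C : set 'rV[R]_n)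
    (x y : 'rV[R]_n) (l : R) :
  @convex_set R 'rV[R]_n C -> C x -> C y -> 0 <= l <= 1 ->
  C (l *: x + (1 - l) *: y).
Proof.
move=> Cc Cx Cy l01.
have := Cc x y (Itv01 (andP l01).1 (andP l01).2) (mem_set Cx) (mem_set Cy).
by rewrite inE.
Qed.

(** * Minimizers on [C] and proximal steps *)

Section minimizer.
Variables (R : realType) (n : nat) (phi : 'rV[R]_n -> \bar R).
Variables (C : set 'rV[R]_n) (m : R -> \bar R).
Hypothesis phi_Ny : forall x, phi x != -oo%E.
Hypothesis C_dom : C `<=` dom phi.

Lemma dom_fin_num x : C x -> phi x \is a fin_num.
Proof. by move=> /C_dom xy; rewrite fin_numE phi_Ny lt_eqF. Qed.

Lemma coercive_sublevel_bounded (r : R) :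
  coercive phi -> exists M, forall x, (phi x <= r%:E)%E -> eucl_norm x <= M.
Proof.
by move=> /(_ r)[M hM]; exists M => x xr; rewrite leNgt; apply/negP => /hM; rewrite ltNge xr.
Qed.

(** By coercivity, the points of [C] with value at most [phi x0] form a compact set. A minimizer
    there also beats the remaining points of [C], whose values exceed [phi x0]. *)
Lemma coercive_argmin : lower_semicontinuous phi -> coercive phi ->
  closed C -> C !=set0 -> argmin_on C phi !=set0.
Proof.
move=> lscf cof Ccl [x0 Cx0].
have fx0 := dom_fin_num Cx0.
pose A := C `&` [set x | (phi x <= phi x0)%E].
have Acl : closed A.
  apply: closedI => //.
  rewrite (_ : [set x | _] = ~` [set x | ((fine (phi x0))%:E < phi x)%E]).
    by apply: open_closedC; move/lower_semicontinuousP: lscf; exact.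
  by apply/seteqP; split => x /=; rewrite fineK// leNgt => /negP.
have [M AM] := coercive_sublevel_bounded (fine (phi x0)) cof.
have Abd : bounded_set A.
  exists M; split; first exact: num_real.
  move=> N MN x [_ /=]; rewrite -(fineK fx0) => /AM xM.
  by rewrite (le_trans (normr_le_eucl_norm x))// (le_trans xM)// ltW.
have [|x [[Cx xx0] xmin]] :=
    lsc_compact_argmin phi_Ny lscf (bounded_closed_compact Abd Acl).
  by exists x0; split => /=.
exists x; split => // y Cy; have [yx0|/ltW x0y] := leP (phi y) (phi x0).
  exact: xmin.
exact: le_trans x0y.
Qed.

Hypothesis m_modulus : is_modulus m.

Lemma modulus_gt0 t : 0 < t -> (0 < m t)%E.
Proof.
move=> t0; case: m_modulus => m0 _ mz; rewrite lt_neqAle m0 ?ltW// andbT.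
by apply/eqP => /esym /(mz _ (ltW t0)) t00; rewrite t00 ltxx in t0.
Qed.

Hypothesis C_convex : @convex_set R 'rV[R]_n C.
Hypothesis phi_uqc : uniformly_quasiconvex_on m C phi.

(** At the midpoint [phi] is no less than the minimum, so the modulus term there cannot be
    positive. *)
Lemma uqc_argmin_unique x y : argmin_on C phi x -> argmin_on C phi y -> x = y.
Proof.
move=> [Cx xmin] [Cy ymin].
have h01 : 0 <= (2^-1 : R) <= 1 by lra.
have Cz := convex_set_comb C_convex Cx Cy h01.
have := phi_uqc Cx Cy h01.
have -> : phi y = phi x by apply/le_anti; rewrite xmin// ymin.
rewrite maxxx => /(le_trans (leeD2r _ (xmin _ Cz))).
rewrite -[leRHS]adde0 leeD2lE ?dom_fin_num//.
have : 0 <= eucl_norm (x - y) := eucl_norm_ge0 _.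
rewrite le_eqVlt => /predU1P[/esym/eucl_norm_eq0/eqP|/modulus_gt0 d0].
  by rewrite subr_eq0 => /eqP.
by rewrite leNgt mule_gt0// lte_fin; lra.
Qed.

(** Minimality of [xb] makes the maximum in uniform quasiconvexity equal to [phi w], and optimality
    of [w] bounds [phi w] by [phi y] plus the penalty at [y]. The finite [phi y] then cancels. *)
Lemma prox_step_modulus p g xb z w l : 0 < p -> 0 < g ->
  argmin_on C phi xb -> argmin_on C (prox_objective phi p g z) w ->
  0 <= l <= 1 ->
  ((l * (1 - l))%:E * m (eucl_norm (xb - w)) <=
   ((p * g)^-1 * eucl_norm (z - (l *: xb + (1 - l) *: w)) `^ p)%:E)%E.
Proof.
move=> p0 g0 [Cxb xbmin] [Cw wmin] l01; set y := (_ + _ *: w)%R.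
have Cy : C y by exact: convex_set_comb.
have := phi_uqc Cxb Cw l01; rewrite -/y.
rewrite (max_idPr (xbmin _ Cw)) => /le_trans le_w.
rewrite -(@leeD2lE _ (phi y)) ?dom_fin_num//; apply: le_w.
apply: le_trans (wmin _ Cy); rewrite /prox_objective leeDl// lee_fin.
by rewrite mulr_ge0 ?powR_ge0// invr_ge0 mulr_ge0 ?ltW.
Qed.

End minimizer.

Lemma powR_little_o (R : realType) (p c K : R) : 1 < p -> 0 < c -> 0 < K ->
  exists2 l : R, 0 < l <= 2^-1 & K * l `^ p < l * (1 - l) * c.
Proof.
(* [a] solves [K * a ^ (p - 1) = c / 4]. With [l <= a] and [l <= 1/2], this gives
   [K * l ^ (p - 1) <= c / 4 < (1 - l) * c]. *)
move=> p1 c0 K0; pose a := (c / (4 * K)) `^ (p - 1)^-1.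
have a0 : 0 < a by rewrite powR_gt0// divr_gt0// mulr_gt0.
pose l := Num.min 2^-1 a.
have l0 : 0 < l by rewrite /l lt_min invr_gt0 ltr0n a0.
have lh : l <= 2^-1 by rewrite /l ge_min lexx.
exists l; first by rewrite l0.
have lp : l `^ (p - 1) <= c / (4 * K).
  have p10 : 0 < p - 1 by lra.
  apply: (@le_trans _ _ (a `^ (p - 1))).
    have la : l <= a by rewrite /l ge_min lexx orbT.
    by apply: ge0_ler_powR => //; rewrite ?nnegrE; exact: ltW.
  rewrite -powRrM mulVf ?gt_eqF// powRr1// ltW// divr_gt0// mulr_gt0//.
have Klp : K * l `^ (p - 1) <= c / 4.
  by rewrite mulrC -ler_pdivlMr// (le_trans lp)// invfM mulrA.
rewrite -(mulr_powRB1 (ltW l0)) ?(lt_trans _ p1)// mulrCA -mulrA ltr_pM2l//.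
by apply: (le_lt_trans Klp); nra.
Qed.

(** * Behaviour of the iterates *)

Section hippa.
Variables (R : realType) (n : nat) (phi : 'rV[R]_n -> \bar R).
Variables (C : set 'rV[R]_n) (p gmin gmax : R).
Variables (g : nat -> R) (x : nat -> 'rV[R]_n).
Hypothesis phi_Ny : forall x, phi x != -oo%E.
Hypothesis C_dom : C `<=` dom phi.
Hypothesis p_gt1 : 1 < p.
Hypothesis gmin_gt0 : 0 < gmin.
Hypothesis x_hippa : hippa_sequence phi C p gmin gmax g x.

Local Notation F := (fun k => fine (phi (x k))).
Local Notation d := (fun k => eucl_norm (x k.+1 - x k)).

Let p_gt0 : 0 < p. Proof. exact: lt_trans p_gt1. Qed.

Lemma hippa_in k : C (x k).
Proof. by case: x_hippa => x0 _ xS; case: k => // k; case: (xS k). Qed.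

Lemma hippa_param_gt0 k : 0 < g k.
Proof. by case: x_hippa => _ /(_ k)/andP[+ _] _; exact: lt_trans. Qed.

Lemma hippa_prox_le k :
  (prox_objective phi p (g k) (x k) (x k.+1) <= phi (x k))%E.
Proof.
case: x_hippa => _ _ /(_ k)[_ /(_ _ (hippa_in k))/le_trans]; apply.
rewrite /prox_objective subrr -(scale0r 0) eucl_normZ normr0 mul0r.
by rewrite powR0 ?gt_eqF// mulr0 adde0.
Qed.

Lemma hippa_nonincreasing : nonincreasing_seq (fun k => phi (x k)).
Proof.
apply/nonincreasing_seqP => k; apply: le_trans (hippa_prox_le k).
rewrite leeDl// lee_fin mulr_ge0 ?powR_ge0// invr_ge0.
by rewrite mulr_ge0 ?ltW ?hippa_param_gt0.
Qed.

(** [phi (x k.+1)] separates consecutive envelopes, whatever the parameters: it is at least the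
    envelope at [x k.+1] and at most the one at [x k]. *)
Lemma hippa_moreau_nonincreasing :
  nonincreasing_seq (fun k => moreau_envelope phi p (g k) C (x k)).
Proof.
apply/nonincreasing_seqP => k.
apply: (@le_trans _ _ (phi (x k.+1))).
  apply: le_trans (hippa_prox_le k.+1); apply: ereal_inf_lbound.
  by exists (x k.+2) => //; exact: hippa_in.
case: x_hippa => _ _ /(_ k)[_ xS].
apply: le_ereal_inf_tmp => _ [y Cy <-]; apply: le_trans (xS _ Cy).
rewrite leeDl// lee_fin mulr_ge0 ?powR_ge0// invr_ge0.
by rewrite mulr_ge0 ?ltW ?hippa_param_gt0.
Qed.

Lemma hippa_fineE k : phi (x k) = (F k)%:E.
Proof. by rewrite fineK// (dom_fin_num phi_Ny C_dom)//; exact: hippa_in. Qed.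

(** Replacing [g k] by [gmax] makes the constant independent of [k]. *)
Lemma hippa_descent k : (p * gmax)^-1 * d k `^ p <= F k - F k.+1.
Proof.
have := hippa_prox_le k; rewrite /prox_objective (hippa_fineE k) (hippa_fineE k.+1).
rewrite -EFinD lee_fin addrC -lerBrDr.
apply: le_trans; rewrite eucl_norm_distC ler_wpM2r ?powR_ge0//.
case: x_hippa => _ /(_ k)/andP[g1 g2] _.
have g0 := hippa_param_gt0 k.
by rewrite lef_pV2 ?posrE ?mulr_gt0// ?(lt_trans g0)// ler_pM2l// ltW.
Qed.

Variable xb : 'rV[R]_n.
Hypothesis xb_min : argmin_on C phi xb.

Lemma hippa_ge_min k : fine (phi xb) <= F k.
Proof.
case: xb_min => Cxb xbm; rewrite -lee_fin -hippa_fineE.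
by rewrite fineK ?(dom_fin_num phi_Ny C_dom)//; apply: xbm; exact: hippa_in.
Qed.

Lemma hippa_nonincreasing_fine : nonincreasing_seq F.
Proof.
move=> i j ij; rewrite -lee_fin -!hippa_fineE.
exact: hippa_nonincreasing.
Qed.

Hypothesis gmax_gt0 : 0 < gmax.

Lemma hippa_series_lty : (\sum_(0 <= k <oo) (d k `^ p)%:E < +oo)%E.
Proof.
have c0 : 0 < (p * gmax)^-1 by rewrite invr_gt0 mulr_gt0.
apply: (@le_lt_trans _ _ ((F 0%N - fine (phi xb)) / (p * gmax)^-1)%:E);
  last by rewrite ltry.
apply: lime_le.
  by apply: is_cvg_nneseries => k _ _; rewrite lee_fin powR_ge0.
apply: nearW => N; rewrite sumEFin lee_fin ler_pdivlMr// mulrC.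
apply: (@le_trans _ _ (F 0%N - F N)); last by rewrite lerB ?hippa_ge_min.
elim: N => [|N IH]; first by rewrite big_geq// mulr0 subrr.
by rewrite big_nat_recr//= mulrDr; have := hippa_descent N; lra.
Qed.

(** [F] is nonincreasing and bounded below, so its decrements tend to 0. By [hippa_descent], a step
    of length at least [e] would force a decrement of at least [(p * gmax)^-1 * e ^ p]. *)
Lemma hippa_step_cvg0 (e : R) : 0 < e -> \forall k \near \oo, d k < e.
Proof.
move=> e0.
have c0 : 0 < (p * gmax)^-1 by rewrite invr_gt0 mulr_gt0.
have Fcvg : cvgn F.
  apply: nonincreasing_is_cvgn; first exact: hippa_nonincreasing_fine.
  by exists (fine (phi xb)) => _ [k _ <-]; exact: hippa_ge_min.
have FS : F k - F k.+1 @[k --> \oo] --> (0 : R).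
  rewrite -(subrr (limn F)); apply: cvgB => //.
  by rewrite (cvg_shiftS F).
have ep : 0 < (p * gmax)^-1 * e `^ p by rewrite mulr_gt0// powR_gt0.
apply: filterS (cvgr0_norm_lt _ FS _ ep) => k kep; rewrite ltNge; apply/negP => ed.
have := le_lt_trans (ler_norm _) kep.
rewrite ltNge => /negP; apply; apply: le_trans (hippa_descent k).
rewrite ler_pM2l//; apply: ge0_ler_powR => //; rewrite ?ltW//.
- by rewrite nnegrE ltW.
- by rewrite nnegrE eucl_norm_ge0.
Qed.

Lemma hippa_bounded : coercive phi -> exists M, forall k, eucl_norm (x k) <= M.
Proof.
move=> /(@coercive_sublevel_bounded _ _ phi (F 0%N)) [M xM].
exists M => k; apply: xM.
by rewrite -hippa_fineE hippa_nonincreasing.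
Qed.

Variable m : R -> \bar R.
Hypothesis m_modulus : is_modulus m.
Hypothesis C_convex : @convex_set R 'rV[R]_n C.
Hypothesis phi_uqc : uniformly_quasiconvex_on m C phi.

Lemma hippa_cvg : coercive phi -> x @ \oo --> xb.
Proof.
move=> /hippa_bounded[M xM].
have [D D0 xbD] : exists2 D, 0 < D & forall k, eucl_norm (xb - x k) <= D.
  (* The 1 ensures [D > 0]. *)
  pose r := Num.max 1 (Num.max M (eucl_norm xb)).
  exists (2 * r) => [|k]; first by rewrite mulr_gt0// lt_max ltr01.
  apply: eucl_norm_add_le; first by rewrite !le_max lexx !orbT.
  by rewrite eucl_normN !le_max xM orbT.
rewrite -(cvg_shiftS x); apply/cvgrPdist_lt => e e0.
(* [m e] may be infinite; a positive real below it suffices. *)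
have [c c0 cm] : exists2 c : R, 0 < c & (c%:E <= m e)%E.
  move: (modulus_gt0 m_modulus e0); case: (m e) => [c|_|//].
    by rewrite lte_fin => c0; exists c.
  by exists 1 => //; rewrite leey.
(* The estimate [|x k - y| <= 2 * l * D] below bounds the penalty at [y] by [K * l ^ p]. *)
pose K := (p * gmin)^-1 * (2 * D) `^ p.
have K0 : 0 < K by rewrite /K mulr_gt0 ?powR_gt0 ?invr_gt0 ?mulr_gt0//.
have [l /andP[l0 lh] Kl] := powR_little_o p_gt1 c0 K0.
have lD0 : 0 < l * D by rewrite mulr_gt0.
apply: filterS (hippa_step_cvg0 lD0) => k dk.
apply: (le_lt_trans (normr_le_eucl_norm _)); rewrite ltNge; apply/negP => ed.
have l01 : 0 <= l <= 1 by lra.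
case: x_hippa => _ /(_ k)/andP[gk _] /(_ k) xSk.
have gk0 := hippa_param_gt0 k.
have := prox_step_modulus phi_Ny C_dom C_convex phi_uqc p_gt0 gk0 xb_min xSk l01.
apply/negP; rewrite -ltNge.
set y := (_ + _ *: _); have yle : eucl_norm (x k - y) <= 2 * (l * D).
  have -> : x k - y = (x k - x k.+1) + (- l) *: (xb - x k.+1).
    by apply/rowP => i; rewrite !mxE; ring.
  apply: eucl_norm_add_le; first by rewrite eucl_norm_distC ltW.
  by rewrite eucl_normZ normrN (ger0_norm (ltW l0)) ler_pM2l.
(* As [m] is monotone and [e <= |xb - x k.+1|], the modulus term is at least [l * (1 - l) * c],
   which exceeds [K * l ^ p]. *)
apply: (@lt_le_trans _ _ ((l * (1 - l) * c)%:E)); last first.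
  rewrite EFinM lee_pmul2l//; last by rewrite lte_fin; nra.
  by rewrite (le_trans cm)//; case: m_modulus => _ + _; apply => //; exact: ltW.
rewrite lte_fin; apply: le_lt_trans Kl.
have [l_ge0 D_ge0] : 0 <= l /\ 0 <= 2 * D by rewrite mulr_ge0 ?ltW.
rewrite /K -mulrA -powRM//.
apply: ler_pM.
- by rewrite invr_ge0 ltW// mulr_gt0.
- exact: powR_ge0.
- by rewrite lef_pV2 ?posrE ?mulr_gt0// ler_pM2l// ltW.
- apply: ge0_ler_powR; rewrite ?nnegrE ?eucl_norm_ge0 ?mulr_ge0//; [exact: ltW..|].
  by rewrite -mulrA [D * l]mulrC.
Qed.

End hippa.

Lemma cluster_points_cvg (R : realType) (V : normedModType R) (x : nat -> V) l :
  x @ \oo --> l -> cluster_points x = [set l].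
Proof.
move=> xl; apply/seteqP; split=> [y [s [s_incr sy]]|_ ->]; last first.
  by exists id; split.
(* A strictly increasing [s] dominates the identity, so it tends to infinity and the subsequence
   inherits the limit [l]. *)
have s_ge k : (k <= s k)%N.
  by elim: k => // k /leq_ltn_trans; apply; exact: s_incr.
have s_cvg : s k @[k --> \oo] --> \oo.
  move=> A [N _ NA]; exists N => // k /= Nk; apply: NA => /=.
  exact: leq_trans (s_ge k).
have := cvg_comp _ _ s_cvg xl => sl.
exact: (cvg_unique (@norm_hausdorff _ V) sy sl).
Qed.

Theorem theorem4p7 (R : realType) (n : nat) (phi : 'rV[R]_n -> \bar R)
    (C : set 'rV[R]_n) (m : R -> \bar R) (p gmin gmax : R)
    (g : nat -> R) (x : nat -> 'rV[R]_n)
    (phi_proper : proper_fun phi)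
    (phi_lsc : lower_semicontinuous phi)
    (phi_coercive : coercive phi)
    (C_nonempty : C !=set0)
    (C_closed : closed C)
    (C_convex : @convex_set R 'rV[R]_n C)
    (C_dom : C `<=` dom phi)
    (m_modulus : is_modulus m)
    (phi_uqc : uniformly_quasiconvex_on m C phi)
    (p_gt1 : 1 < p)
    (gmin_gt0 : 0 < gmin)
    (gmin_lt_gmax : gmin < gmax)
    (x_hippa : hippa_sequence phi C p gmin gmax g x) :
  [/\ nonincreasing_seq (fun k => phi (x k)) /\
      nonincreasing_seq (fun k => moreau_envelope phi p (g k) C (x k)),
      (\sum_(0 <= k <oo) (eucl_norm (x k.+1 - x k)%R `^ p)%:E < +oo)%E,
      exists M : R, forall k, eucl_norm (x k) <= M,
      cluster_points x = argmin_on C phi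
    & exists xbar : 'rV[R]_n,
        argmin_on C phi = [set xbar] /\ x @ \oo --> xbar].
Proof.
have [phi_Ny _] := phi_proper.
have gmax_gt0 : 0 < gmax := lt_trans gmin_gt0 gmin_lt_gmax.
have [xb xb_min] :=
  coercive_argmin phi_Ny C_dom phi_lsc phi_coercive C_closed C_nonempty.
have argminE : argmin_on C phi = [set xb].
  apply/seteqP; split=> [y ymin|_ -> //].
  exact: (uqc_argmin_unique phi_Ny C_dom m_modulus C_convex phi_uqc).
have x_cvg : x @ \oo --> xb.
  exact: (hippa_cvg phi_Ny C_dom p_gt1 gmin_gt0 x_hippa xb_min gmax_gt0
    m_modulus C_convex phi_uqc).
split.
- split; first exact: (hippa_nonincreasing p_gt1 gmin_gt0 x_hippa).
  exact: (hippa_moreau_nonincreasing p_gt1 gmin_gt0 x_hippa).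
- exact: (hippa_series_lty phi_Ny C_dom p_gt1 gmin_gt0 x_hippa xb_min).
- exact: (hippa_bounded phi_Ny C_dom p_gt1 gmin_gt0 x_hippa).
- by rewrite argminE; exact: cluster_points_cvg.
- by exists xb.
Qed.
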